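(* If an interval linear program, given by an interval matrix $\mathbf{A}$ and interval vectors $\mathbf{b},\mathbf{c}$, has strongly zero duality gap, then (i) the primal interval linear program is weakly feasible or the dual interval linear program is strongly feasible, and (ii) the primal interval linear program is strongly feasible or the dual interval linear program is weakly feasible.
   Context: For real matrices $\underline{A}\le\overline{A}$ in $\mathbb{R}^{m\times n}$ (entrywise order), the interval matrix $\mathbf{A}=[\underline{A},\overline{A}]$ is the set $\{A\in\mathbb{R}^{m\times n}:\underline{A}\le A\le\overline{A}\}$; interval vectors $\mathbf{b}=[\underline b,\overline b]\subseteq\mathbb{R}^m$ and $\mathbf{c}=[\underline c,\overline c]\subseteq\mathbb{R}^n$ are defined analogously. An interval linear program (ILP) is the family of linear programs $\min\{c^{\top}x : x\in\mathcal{M}(A,b)\}$ with $A\in\mathbf{A}$, $b\in\mathbf{b}$, $c\in\mathbf{c}$, where $\mathcal{M}(A,b)\subseteq\mathbb{R}^n$ is described by linear equations and inequalities of a fixed form: each row is of the form $(Ax)_i=b_i$, $(Ax)_i\le b_i$ or $(Ax)_i\ge b_i$, and each variable is free, nonnegative or nonpositive, the same pattern being used for all $(A,b,c)$. A choice $(A,b,c)$ with $A\in\mathbf{A},b\in\mathbf{b},c\in\mathbf{c}$ is called a scenario. The dual ILP is the family of the usual linear programming duals of the scenarios: $\max b^{\top}y$ with $y_i$ free, $\le 0$, $\ge 0$ according to whether row $i$ is an equation, a $\le$ or a $\ge$ inequality, and with $(A^{\top}y)_j= c_j$, $\le c_j$, $\ge c_j$ according to whether $x_j$ is free, nonnegative,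 nonpositive. An ILP (primal or dual) is weakly feasible if it is feasible for at least one scenario and strongly feasible if it is feasible for all scenarios. The duality gap of a linear program is the difference between the primal and dual optimal values; it is zero if and only if at least one of the primal or the dual program is feasible, and it is $\infty$ otherwise. The duality gap of the ILP is strongly zero if all scenarios have zero duality gap. *)

(* Defs.v *)
From mathcomp Require Import all_boot all_order all_algebra.
From mathcomp Require Import all_classical all_reals ereal.

Set Implicit Arguments.
Unset Strict Implicit.
Unset Printing Implicit Defensive.

Import Order.TTheory GRing.Theory Num.Theory.

Local Open Scope classical_set_scope.
Local Open Scope ring_scope.

Definition mx_le (R : realType) (m n : nat) (A B : 'M[R]_(m, n)) : Prop :=
  forall i j, A i j <= B i j.

Definition mx_interval (R : realType) (m n : nat) (L U : 'M[R]_(m, n)) :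
    set 'M[R]_(m, n) :=
  [set A | mx_le L A /\ mx_le A U].

Variant row_kind := RowEq | RowLe | RowGe.

Variant var_kind := VarFree | VarNonneg | VarNonpos.

Record lp_data (R : realType) (m n : nat) := LPData {
  lp_mx : 'M[R]_(m, n);
  lp_rhs : 'cV[R]_m;
  lp_cost : 'cV[R]_n
}.

Section LinearProgram.
Variables (R : realType) (m n : nat).
Variables (rows : 'I_m -> row_kind) (vars : 'I_n -> var_kind).
Implicit Types P : lp_data R m n.

Definition primal_feasible_set P : set 'cV[R]_n :=
  [set x : 'cV[R]_n |
    (forall i, match rows i with
               | RowEq => (lp_mx P *m x) i 0 = lp_rhs P i 0
               | RowLe => (lp_mx P *m x) i 0 <= lp_rhs P i 0
               | RowGe => (lp_mx P *m x) i 0 >= lp_rhs P i 0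
               end) /\
    (forall j, match vars j with
               | VarFree => True
               | VarNonneg => x j 0 >= 0
               | VarNonpos => x j 0 <= 0
               end)].

Definition dual_feasible_set P : set 'cV[R]_m :=
  [set y : 'cV[R]_m |
    (forall i, match rows i with
               | RowEq => True
               | RowLe => y i 0 <= 0
               | RowGe => y i 0 >= 0
               end) /\
    (forall j, match vars j with
               | VarFree => ((lp_mx P)^T *m y) j 0 = lp_cost P j 0
               | VarNonneg => ((lp_mx P)^T *m y) j 0 <= lp_cost P j 0
               | VarNonpos => ((lp_mx P)^T *m y) j 0 >= lp_cost P j 0
               end)].

(* The infimum (supremum) over an empty feasible set is +oo (-oo). *)
Definition primal_value P : \bar R :=
  ereal_inf [set (((lp_cost P)^T *m x) 0 0)%:E | x in primal_feasible_set P].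

Definition dual_value P : \bar R :=
  ereal_sup [set (((lp_rhs P)^T *m y) 0 0)%:E | y in dual_feasible_set P].

(* Equal values, including equal infinite ones, have gap 0: an infeasible
   program whose dual is unbounded has zero gap, whereas the library's
   subtraction gives +oo - +oo = -oo.  If both programs are infeasible the gap
   is +oo - (-oo) = +oo. *)
Definition duality_gap P : \bar R :=
  if primal_value P == dual_value P then 0%E
  else (primal_value P - dual_value P)%E.

End LinearProgram.

Section IntervalLinearProgram.
Variables (R : realType) (m n : nat).

Definition scenarios (A : set 'M[R]_(m, n)) (b : set 'cV[R]_m)
    (c : set 'cV[R]_n) : set (lp_data R m n) :=
  [set P | [/\ A (lp_mx P), b (lp_rhs P) & c (lp_cost P)]].

Variables (rows : 'I_m -> row_kind) (vars : 'I_n -> var_kind).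
Variable S : set (lp_data R m n).

Definition primal_weakly_feasible : Prop :=
  exists2 P, S P & primal_feasible_set rows vars P !=set0.

Definition primal_strongly_feasible : Prop :=
  forall P, S P -> primal_feasible_set rows vars P !=set0.

Definition dual_weakly_feasible : Prop :=
  exists2 P, S P & dual_feasible_set rows vars P !=set0.

Definition dual_strongly_feasible : Prop :=
  forall P, S P -> dual_feasible_set rows vars P !=set0.

Definition strongly_zero_duality_gap : Prop :=
  forall P, S P -> duality_gap rows vars P = 0%E.

End IntervalLinearProgram.

(* Main.v *)
Require Import Defs.
From mathcomp Require Import all_boot all_order all_algebra.
From mathcomp Require Import all_classical all_reals ereal.

(** Only one fact about a single linear program matters: if both the primal and
    the dual are infeasible, then the infimum over the empty set is +oo, the
    supremum over the empty set is -oo, and the gap is +oo rather than 0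
    ([zero_gap_feasible]).  Hence strongly zero duality gap makes every scenario
    primal feasible or dual feasible.  If no scenario is primal feasible, all
    of them are dual feasible, which is (i); if no scenario is dual feasible,
    all of them are primal feasible, which is (ii). *)

Lemma zero_gap_feasible (R : realType) (m n : nat)
  (rows : 'I_m -> row_kind) (vars : 'I_n -> var_kind) (P : lp_data R m n) :
  duality_gap rows vars P = 0%E ->
  (primal_feasible_set rows vars P !=set0)%classic \/
  (dual_feasible_set rows vars P !=set0)%classic.
Proof.
move=> gap0.
have [primal0|/set0P] := eqVneq (primal_feasible_set rows vars P) set0;
  last by left.
have [dual0|/set0P] := eqVneq (dual_feasible_set rows vars P) set0;
  last by right.
by move: gap0; rewrite /duality_gap /primal_value /dual_value primal0 dual0
  !image_set0 ereal_inf0 ereal_sup0.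
Qed.

Theorem proposition6 (R : realType) (m n : nat)
  (rows : 'I_m -> row_kind) (vars : 'I_n -> var_kind)
  (Al Au : 'M[R]_(m, n)) (bl bu : 'cV[R]_m) (cl cu : 'cV[R]_n)
  (hA : mx_le Al Au) (hb : mx_le bl bu) (hc : mx_le cl cu) :
  let S := scenarios (mx_interval Al Au) (mx_interval bl bu)
                     (mx_interval cl cu) in
  strongly_zero_duality_gap rows vars S ->
  (primal_weakly_feasible rows vars S \/ dual_strongly_feasible rows vars S) /\
  (primal_strongly_feasible rows vars S \/ dual_weakly_feasible rows vars S).
Proof.
move=> S gap0; split.
- have [|noP] := pselect (primal_weakly_feasible rows vars S); first by left.
  right=> P SP; have [feasP|//] := zero_gap_feasible _ _ _ _ _ _ (gap0 P SP).
  by case: noP; exists P.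
- have [|noD] := pselect (dual_weakly_feasible rows vars S); first by right.
  left=> P SP; have [//|feasD] := zero_gap_feasible _ _ _ _ _ _ (gap0 P SP).
  by case: noD; exists P.
Qed.
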